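(* Let $G$ be a weakly branch group acting on a regular rooted tree $T$, let $X=\partial T$ be the boundary of $T$, let $\mu$ be the uniform Bernoulli measure on $X$ and let $\Sigma$ be the sigma-algebra of all measurable subsets of $X$. Then the action of $G$ on $(X,\Sigma,\mu)$ is absolutely non-free.
   Context: Let $d\ge2$ and let $\mathcal A_d$ be an alphabet with $d$ elements. The $d$-regular rooted tree $T=T_d$ has as vertices all finite words over $\mathcal A_d$, two words being adjacent if one is obtained from the other by adding one letter at the end; the root is the empty word. $V_n$ is the set of words of length $n$ (the $n$-th level), and $T_v$ is the subtree with root $v$. $\mathrm{Aut}(T)$ is the group of graph automorphisms of $T$ (these preserve the root and the levels). The boundary $X=\partial T$ is the set of infinite paths without backtracking from the root, identified with infinite words over $\mathcal A_d$ with the product topology; for a vertex $v$, $X_v\subset X$ is the set of paths through $v$. The uniform Bernoulli measure $\mu$ is the probability measure with $\mu(X_v)=d^{-n}$ for $v\in V_n$; it is $\mathrm{Aut}(T)$-invariant. For $G<\mathrm{Aut}(T)$ and a vertex $v$, the rigid stabilizer $\mathrm{rist}_G(v)$ is the subgroup of elements of $G$ acting trivially on the complement of $T_v$; $\mathrm{rist}_G(n)$ is the subgroup generated by $\mathrm{rist}_G(v)$, $v\in V_n$. The group $G<\mathrm{Aut}(T)$ is weakly branch if it acts transitively on each level $V_n$ and $\mathrm{rist}_G(n)$ is infinite for each $n$ (equivalently, $\mathrm{rist}_G(v)$ is nontrivial for every vertex $v$). An action of a group $G$ on a measure space $(X,\Sigma,\mu)$ is absolutely non-free if for every measurable set $A$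 and every $\epsilon>0$ there exists $g\in G$ with $\mu(\mathrm{Fix}(g)\,\Delta\,A)<\epsilon$, where $\mathrm{Fix}(g)=\{x\in X:gx=x\}$. *)

(* Defs.v *)
From HB Require Import structures.
From mathcomp Require Import all_boot all_order all_algebra.
From mathcomp Require Import all_classical all_reals all_analysis.
From mathcomp Require Import zify.

Set Implicit Arguments.
Unset Strict Implicit.
Unset Printing Implicit Defensive.

Local Open Scope group_scope.
Local Open Scope classical_set_scope.

(* Nonempty finite alphabets. The distinguished letter is only there because
   MathComp-Analysis requires measurable types to be pointed. *)
#[short(type="pfinType")]
HB.structure Definition PointedFinite := {T of Finite T & Pointed T}.

HB.instance Definition _ (n : nat) := isPointed.Build 'I_n.+1 ord0.

Section Tree.
Variable A : pfinType.

(* The vertices of the tree are the words over A; the root is [::]. *)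
Definition child (v w : seq A) : bool := [exists a : A, w == rcons v a].

Definition adjacent (v w : seq A) : bool := child v w || child w v.

Definition is_tree_aut (f : seq A -> seq A) : Prop :=
  bijective f /\ forall v w, adjacent (f v) (f w) = adjacent v w.

Record tree_aut := TreeAut {
  tree_aut_fun :> seq A -> seq A;
  tree_autP : is_tree_aut tree_aut_fun }.

HB.instance Definition _ := gen_eqMixin tree_aut.
HB.instance Definition _ := gen_choiceMixin tree_aut.

Lemma tree_aut_ext (g h : tree_aut) : g =1 h -> g = h.
Proof.
case: g h => [f fP] [f' f'P] /= /funext ff'; subst f'.
by congr TreeAut; exact: Prop_irrelevance.
Qed.

Fact tree_aut_one_subproof : is_tree_aut id.
Proof. by split=> //; exists id. Qed.

Fact tree_aut_mul_subproof (g h : tree_aut) : is_tree_aut (g \o h).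
Proof.
case: (tree_autP g) (tree_autP h) => [bg ag] [bh ah].
by split; [exact: bij_comp | move=> v w /=; rewrite ag ah].
Qed.

Fact tree_aut_inv_ex (g : tree_aut) :
  exists k : tree_aut, cancel g k /\ cancel k g.
Proof.
have [[f fK Kf] ag] := tree_autP g.
have fP : is_tree_aut f.
  by split; [exists g | move=> v w; rewrite -ag !Kf].
by exists (TreeAut fP).
Qed.

Definition tree_aut_one := TreeAut tree_aut_one_subproof.
Definition tree_aut_mul (g h : tree_aut) := TreeAut (tree_aut_mul_subproof g h).
Definition tree_aut_inv (g : tree_aut) := projT1 (cid (tree_aut_inv_ex g)).

Fact tree_aut_mulA : associative tree_aut_mul.
Proof. by move=> g h k; exact: tree_aut_ext. Qed.
Fact tree_aut_mul1g : left_id tree_aut_one tree_aut_mul.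
Proof. by move=> g; exact: tree_aut_ext. Qed.
Fact tree_aut_mulg1 : right_id tree_aut_one tree_aut_mul.
Proof. by move=> g; exact: tree_aut_ext. Qed.
Fact tree_aut_mulVg : left_inverse tree_aut_one tree_aut_inv tree_aut_mul.
Proof.
move=> g; apply: tree_aut_ext => v /=; rewrite /tree_aut_inv.
by case: cid => k [gk kg] /=; rewrite gk.
Qed.
Fact tree_aut_mulgV : right_inverse tree_aut_one tree_aut_inv tree_aut_mul.
Proof.
move=> g; apply: tree_aut_ext => v /=; rewrite /tree_aut_inv.
by case: cid => k [gk kg] /=; rewrite kg.
Qed.

(* The product of g and h is g \o h. *)
HB.instance Definition _ := isGroup.Build tree_aut
  tree_aut_mulA tree_aut_mul1g tree_aut_mulg1 tree_aut_mulVg tree_aut_mulgV.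

End Tree.

Definition is_subgroup (gT : groupType) (H : set gT) : Prop :=
  group_closed [in H].

Definition generated (gT : groupType) (S : set gT) : set gT :=
  smallest (@is_subgroup gT) S.

Section WeaklyBranch.
Variables (A : pfinType) (G : set (tree_aut A)).

Definition rist (v : seq A) : set (tree_aut A) :=
  [set g | G g /\ forall w, ~~ prefix v w -> g w = w].

Definition rist_level (n : nat) : set (tree_aut A) :=
  generated (\bigcup_(v in [set v : seq A | size v = n]) rist v).

Definition weakly_branch : Prop :=
  (forall v w : seq A, size v = size w -> exists2 g, G g & g v = w) /\
  (forall n, infinite_set (rist_level n)).

End WeaklyBranch.

(* Infinite paths from the root, encoded as infinite words. *)
Definition boundary (A : pfinType) : Type :=
  prod_topology (fun _ : nat => discrete_topology A).

HB.instance Definition _ (A : pfinType) := Pointed.on (boundary A).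
HB.instance Definition _ (A : pfinType) := Topological.on (boundary A).
(* The Borel sigma-algebra. *)
HB.instance Definition _ (A : pfinType) :=
  Measurable.copy (boundary A) (g_sigma_algebraType (@open (boundary A))).

Section BoundaryAction.
Variable A : pfinType.
Implicit Types (x : boundary A) (v w : seq A) (g : tree_aut A).

(* The n-th vertex of the path x. *)
Definition vertex x (n : nat) : seq A := mkseq (x : nat -> A) n.

Definition cylinder v : set (boundary A) := [set x | vertex x (size v) = v].

(* g maps the path with vertices vertex x n to the path with vertices
   g (vertex x n), see vertex_baction; its n-th letter is the last letter of
   g (vertex x n.+1), and the default value of last is never used. *)
Definition baction g x : boundary A :=
  fun n => last (x n) (g (vertex x n.+1)).

Let nbrs v : seq (seq A) :=
  (if v is a :: s then [:: belast a s] else [::])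
    ++ [seq rcons v a | a <- enum A].

Let mem_nbrs v w : (w \in nbrs v) = adjacent v w.
Proof.
rewrite /nbrs mem_cat orbC /adjacent; congr orb.
  apply/mapP/existsP => [[a _ ->]|[a /eqP ->]]; first by exists a.
  by exists a => //; rewrite mem_enum.
case: v => [|a s].
  rewrite in_nil; apply/esym/negbTE/existsPn => a.
  by case: w.
rewrite inE lastI; apply/eqP/existsP => [->|[b /eqP/rcons_inj[]] //].
by exists (last a s).
Qed.

Let uniq_nbrs v : uniq (nbrs v).
Proof.
rewrite /nbrs cat_uniq map_inj_uniq ?enum_uniq; last first.
  by move=> a b /rcons_inj[].
case: v => [|a s] //=; rewrite andbT; last first.
  apply/hasPn => w /mapP[b _ ->]; rewrite inE; apply/eqP => /(congr1 size).
  by rewrite headI /= size_behead size_rcons size_belast /=; lia.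
by rewrite has_pred0.
Qed.

Let size_nbrs v : size (nbrs v) = ((v != [::]) + #|A|)%N.
Proof. by rewrite /nbrs size_cat size_map -cardE; case: v. Qed.

Let size_nbrs_aut g v : size (nbrs (g v)) = size (nbrs v).
Proof.
have [[f fK Kf] ag] := tree_autP g.
rewrite -(size_map g (nbrs v)); apply: perm_size; apply: uniq_perm.
- exact: uniq_nbrs.
- by rewrite map_inj_uniq ?uniq_nbrs //; exact: can_inj fK.
- move=> w; rewrite -[w]Kf mem_map ?mem_nbrs ?ag //; exact: can_inj fK.
Qed.

Lemma tree_aut_root g : g [::] = [::].
Proof.
have := size_nbrs_aut g [::]; rewrite !size_nbrs eqxx => /eqP.
by rewrite eqn_add2r; case: (g [::]).
Qed.

Lemma tree_aut_child g v a : exists b, g (rcons v a) = rcons (g v) b.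
Proof.
have [[f fK Kf] ag] := tree_autP g; have gI := can_inj fK.
elim/last_ind: v a => [|v c IH] a.
  have := ag [::] [:: a]; rewrite tree_aut_root {2}/adjacent.
  have -> : child [::] [:: a] by apply/existsP; exists a.
  case/orP => /existsP[b /eqP]; first by move=> ->; exists b.
  by case: (g [:: a]).
have := ag (rcons v c) (rcons (rcons v c) a); rewrite {2}/adjacent.
have -> : child (rcons v c) (rcons (rcons v c) a) by apply/existsP; exists a.
case/orP => /existsP[b /eqP]; first by move=> ->; exists b.
have [b' ->] := IH c => /rcons_inj[] /gI vE.
by move/(congr1 size): vE; rewrite !size_rcons; lia.
Qed.

Lemma size_tree_aut g v : size (g v) = size v.
Proof.
elim/last_ind: v => [|v a IH]; first by rewrite tree_aut_root.
by have [b ->] := tree_aut_child g v a; rewrite !size_rcons IH.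
Qed.

Lemma vertexS x n : vertex x n.+1 = rcons (vertex x n) (x n).
Proof. by rewrite /vertex mkseqS. Qed.

Lemma vertex_baction g x n : vertex (baction g x) n = g (vertex x n).
Proof.
elim: n => [|n IH]; first by rewrite tree_aut_root.
rewrite vertexS IH /baction vertexS.
by have [b ->] := tree_aut_child g (vertex x n) (x n); rewrite last_rcons.
Qed.

Lemma vertex_inj x y : vertex x =1 vertex y -> x = y.
Proof.
move=> xy; apply: funext => n.
by have := xy n.+1; rewrite !vertexS => /rcons_inj[].
Qed.

Lemma baction1 x : baction 1 x = x.
Proof. by apply: vertex_inj => n; rewrite vertex_baction. Qed.

Lemma bactionM g h x : baction (g * h) x = baction g (baction h x).
Proof. by apply: vertex_inj => n; rewrite !vertex_baction. Qed.

End BoundaryAction.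

Definition uniform_bernoulli (A : pfinType) (R : realType)
    (mu : probability (boundary A) R) : Prop :=
  forall v : seq A, mu (cylinder v) = ((#|A|%:R ^- size v)%R : R)%:E.

Section AbsolutelyNonFree.
Context (d : measure_display) (X : measurableType d) (R : realType).
Variables (mu : {measure set X -> \bar R}%R) (gT : groupType).

Definition fixed_points (act : gT -> X -> X) (g : gT) : set X :=
  [set x | act g x = x].

Definition absolutely_nonfree (G : set gT) (act : gT -> X -> X) : Prop :=
  forall B : set X, measurable B -> forall e : R, (0 < e)%R ->
  exists2 g, G g & (mu (fixed_points act g `+` B) < e%:E)%E.

End AbsolutelyNonFree.

(* Main.v *)
Require Import Defs.
From mathcomp Require Import all_boot all_order all_fingroup all_algebra.
From mathcomp Require Import all_classical all_reals all_analysis.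

Set Implicit Arguments.
Unset Strict Implicit.
Unset Printing Implicit Defensive.

(** The action is shown to be absolutely non-free in two steps.

    Measure theory reduces the question to clopen sets. A union C of cylinders
    of level n approximates any Borel set in measure, and any set measurable
    for the completed measure is close to a Borel set
    ([measurable_level_approx], [caratheodory_borel_approx]). As the outer
    measure of symmetric differences obeys the triangle inequality, it suffices
    to find g in G whose fixed points are close to C.

    The group theory then finds g fixing C pointwise and moving almost every
    point outside C ([few_fixed_words]). Let K be the subgroup of the elements
    of G that fix C pointwise; it contains rist(v) for each v of level n outside
    C. Rigid stabilizers have arbitrarily large orbits, uniformly: for each k
    there is a level m at which every word y has at least k + 1 images under
    rist(y_1 ... y_n) ([rist_large_orbits]). Indeed rist(w) moves each word at
    some level below w, and repeating this with longer and longer prefixes w of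
    y gives images of y that leave y at different levels, hence are distinct.
    So K acts on the level m words outside C with orbits of size at least
    k + 1, through a finite group of permutations. The average number of fixed
    points of an element of this group is the number of orbits, by the
    orbit-counting (Burnside) lemma, so some g in K fixes at most a fraction
    1/(k + 1) of the words ([burnside_few_fixpoints]). A path fixed by g passes
    through a word fixed by g at level m, so Fix(g) exceeds C by a set of
    measure at most 1/(k + 1). *)

(** * Permutation groups with large orbits *)

(** The minimum over [H] of the number of fixed points is at most the average,
    which is the number of orbits. *)
Lemma burnside_few_fixpoints (T : finType) (H : {group {perm T}}) (S : {set T})
    (k : nat) :
  [acts H, on S | 'P]%act ->
  {in S, forall x, k <= #|orbit 'P%act H x|} ->
  exists2 s, s \in H & k * #|'Fix_(S | 'P)[s]%g| <= #|S|.
Proof.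
move=> actsHS leorb.
have korb : k * #|orbit 'P%act H @: S| <= #|S|.
  rewrite -(acts_sum_card_orbit actsHS) mulnC -sum_nat_const.
  by apply: leq_sum => _ /imsetP[x Sx ->]; exact: leorb.
have [/existsP[s /andP[Hs les]]|/existsPn none] :=
  boolP [exists s, (s \in H) && (k * #|'Fix_(S | 'P)[s]%g| <= #|S|)].
  by exists s.
have := Frobenius_Cauchy actsHS => /(congr1 (muln k)).
rewrite big_distrr mulnA /= => sumE.
have : \sum_(a in H) #|S|.+1 <= k * #|orbit 'P%act H @: S| * #|H|.
  rewrite -sumE; apply: leq_sum => a Ha.
  by have := none a; rewrite Ha -ltnNge.
rewrite sum_nat_const mulnC leq_pmul2r ?cardG_gt0 //.
by move=> /leq_trans/(_ korb); rewrite ltnn.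
Qed.

(** * Rigid stabilizers *)

Section Tree.
Variable A : pfinType.
Implicit Types (v w y z : seq A) (g h : tree_aut A).

Lemma tree_aut_inj g : injective g.
Proof. by have [/bij_inj] := tree_autP g. Qed.

Lemma tree_aut_take g n w : g (take n w) = take n (g w).
Proof.
elim/last_ind: w => [|w a IH]; first by rewrite /= tree_aut_root.
have [b gwa] := tree_aut_child g w a.
have [lewn|ltwn] := leqP (size w).+1 n.
  by rewrite !take_oversize // ?size_tree_aut ?size_rcons.
by rewrite gwa -!cats1 !takel_cat ?size_tree_aut // IH.
Qed.

Lemma tree_autK g : cancel g (g^-1)%g.
Proof. by move=> w; rewrite -[LHS]/((g^-1 * g)%g w) mulVg. Qed.

Lemma tree_autVK g : cancel (g^-1)%g g.
Proof. by move=> w; rewrite -[LHS]/((g * g^-1)%g w) mulgV. Qed.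

Section Subgroup.
Variable G : set (tree_aut A).
Hypothesis subG : is_subgroup G.

Lemma subgroup1 : G 1%g.
Proof. by have [/set_mem] := subG. Qed.

Lemma subgroupM g h : G g -> G h -> G (g * h)%g.
Proof. 
by move=> /mem_set Gg /mem_set Gh; apply/set_mem/(group_closedM subG).
Qed.

Lemma subgroupV g : G g -> G g^-1%g.
Proof. by move=> /mem_set Gg; apply/set_mem/(group_closedV subG). Qed.

(** [rist] only asks for the words outside the subtree at [v] to be fixed; as
    [g v] has the length of [v], it could differ from [v] only by being one of
    these words, against injectivity. *)
Lemma rist_fix v g : rist G v g -> g v = v.
Proof.
move=> [_ gfix]; apply/eqP/negPn/negP => gvv.
have /gfix /tree_aut_inj : ~~ prefix v (g v).
  by rewrite prefixE take_oversize ?size_tree_aut.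
by move/eqP; rewrite (negPf gvv).
Qed.

Lemma rist_prefix v w g : prefix v w -> rist G w g -> rist G v g.
Proof.
move=> vw [Gg gfix]; split=> // u vu; apply: gfix; apply: contra vu.
exact: prefix_trans.
Qed.

Lemma rist_take_fix n y g : rist G (take n y) g -> take n (g y) = take n y.
Proof. by rewrite -tree_aut_take => /rist_fix. Qed.

Lemma rist_conj v g h : G h -> rist G v g -> rist G (h v) (h * g * h^-1)%g.
Proof.
move=> Gh [Gg gfix]; split.
  by apply: subgroupM; [exact: subgroupM | exact: subgroupV].
move=> w hvw; rewrite -[LHS]/(h (g (h^-1%g w))) gfix ?tree_autVK //.
apply: contra hvw; rewrite !prefixE size_tree_aut => /eqP vE.
by rewrite -{2}vE tree_aut_take tree_autVK.
Qed.

Hypothesis wbG : weakly_branch G.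

(** If every rigid stabilizer of level [n] were trivial, so would be the group
    that they generate, which is infinite. *)
Lemma rist_nontrivial n : exists v w g, [/\ size v = n, rist G v g & g w != w].
Proof.
have [_ /(_ n) inf] := wbG.
apply: contrapT => none; apply: inf; apply: (@sub_finite_set _ _ [set 1%g]); last first.
  exact: finite_set1.
apply: smallest_sub.
  split; first exact/mem_set.
  by move=> x y /set_mem -> /set_mem ->; apply/mem_set; rewrite /= divg1.
move=> g [v /= vn ristg]; apply: tree_aut_ext => w.
by apply/eqP/negPn/negP => gw; apply: none; exists v, w, g.
Qed.

(** One nontrivial element of one rigid stabilizer of level [n] moves one word
    [w]; since [G] is transitive on the level of [w], its conjugates move every
    word of this level, each inside the right subtree. *)
Lemma rist_moves n : exists2 m, n <= m &
  forall y, size y = m -> exists2 g, rist G (take n y) g & g y != y.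
Proof.
have [v [w [g [vn ristg gw]]]] := rist_nontrivial n.
have vw : take n w = v.
  apply/eqP; rewrite -vn -prefixE; apply: contraR gw => vw.
  by apply/eqP; case: ristg => _; apply.
exists (size w).
  by rewrite -vn -vw size_take_min geq_minr.
move=> y yw; have [trG _] := wbG; have [h Gh hw] := trG _ _ (esym yw).
exists (h * g * h^-1)%g.
  by rewrite -hw -tree_aut_take vw; exact: rist_conj.
rewrite -[X in X != _]/(h (g (h^-1%g y))) -hw tree_autK.
by rewrite (inj_eq (@tree_aut_inj _)).
Qed.

(** Take [p] such that some [g] in [rist (take n y)] moves [take p y]. The images
    of [y] obtained from level [p] by induction all extend [take p y], so [g y]
    is a new one. *)
Lemma rist_large_orbits k n : exists2 m, n <= m &
  forall y, size y = m -> exists s : seq (seq A), [/\ uniq s, size s = k.+1 &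
    {in s, forall z, exists2 g, rist G (take n y) g & z = g y}].
Proof.
elim: k n => [|k IH] n.
  exists n => // y _; exists [:: y]; split=> // _ /[!inE]/eqP ->.
  by exists 1%g => //; split=> //; exact: subgroup1.
have [p np moves] := rist_moves n; have [m pm {}IH] := IH p.
exists m => [|y ym]; first exact: leq_trans pm.
have [s [us ss sorb]] := IH y ym.
have [|g] := moves (take p y); first by rewrite size_takel // ym.
rewrite take_takel // => ristg gy; exists (g y :: s); split=> /=.
- rewrite us andbT; apply/negP => /sorb[h /rist_take_fix hy gyE].
  by move: gy; rewrite tree_aut_take gyE hy eqxx.
- by rewrite ss.
- move=> z /[!inE]/orP[/eqP ->|/sorb[h risth ->]]; first by exists g.
  exists h => //; apply: rist_prefix risth.
  by rewrite prefixE size_takel ?take_takel // ym (leq_trans np).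
Qed.

(** The elements of [G] that fix the subtrees selected by [C] permute the words
    of level [m] outside these subtrees. An orbit of this action contains an
    orbit of a rigid stabilizer of level [n], hence more than [k] words. *)
Lemma few_fixed_words (C : pred (seq A)) n k : exists m g, [/\ n <= m, G g,
  forall w, n <= size w -> C (take n w) -> g w = w &
  k.+1 * #|[pred t : m.-tuple A | ~~ C (take n t) & g t == t]| <= #|A| ^ m].
Proof.
have [m nm orb] := rist_large_orbits k n.
pose K g := G g /\ forall w, n <= size w -> C (take n w) -> g w = w.
pose H := [set s : {perm m.-tuple A} |
  `[< exists2 g, K g & forall t, s t = g t :> seq A >]].
have permK g : exists s : {perm m.-tuple A}, forall t, s t = g t :> seq A.
  have gt (t : m.-tuple A) : size (g t) == m by rewrite size_tree_aut size_tuple.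
  have ginj : injective (fun t => Tuple (gt t)).
    by move=> t u /(congr1 val)/tree_aut_inj/val_inj.
  by exists (perm ginj) => t; rewrite permE.
(* [H] is the finite permutation group that [K] induces on the level [m]. *)
have gH : group_set H.
  apply/group_setP; split.
    rewrite !inE; exists 1%g => [|t]; last by rewrite perm1.
    by split=> //; exact: subgroup1.
  move=> s t; rewrite !inE => -[g [Gg gfix] sg] [h [Gh hfix] th].
  exists (h * g)%g; last by move=> x; rewrite permM th sg.
  split; first exact: subgroupM.
  by move=> w nw Cw; rewrite -[LHS]/(h (g w)) gfix // hfix.
pose S := [set t : m.-tuple A | ~~ C (take n t)].
have Kfix (s : {perm m.-tuple A}) (t : m.-tuple A) : s \in H -> C (take n t) -> s t = t.
  rewrite !inE => -[g [_ gfix] sg] Ct.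
  by apply: val_inj; rewrite /= sg gfix // size_tuple.
have actsHS : [acts (Group gH), on S | 'P]%act.
  apply/actsP => s Hs t; rewrite !inE /= apermE.
  apply/idP/idP; apply: contra => Ct; first by rewrite Kfix.
  have st : s t = t by apply: (@perm_inj _ s); rewrite [LHS]Kfix.
  by rewrite -st.
have [t|s Hs les] := burnside_few_fixpoints (k := k.+1) actsHS.
  rewrite inE => Ct; have [|s [us <- sorb]] := orb t; first exact: size_tuple.
  have /= := @uniq_leq_size _ s [seq val u | u <- enum (orbit 'P%act (Group gH) t)] us.
  rewrite size_map -cardE; apply => z /sorb[g ristg ->].
  have [u ug] := permK g; rewrite -ug map_f // mem_enum.
  apply/orbitP; exists u => //; rewrite !inE; exists g => //.
  have [Gg gfix] := ristg; split=> // w nw Cw; apply: gfix.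
  rewrite prefixE size_takel ?size_tuple //.
  by apply: contra Ct => /eqP <-.
have := Hs; rewrite !inE => -[g [Gg gfix] sg].
exists m, g; split=> //.
rewrite -card_tuple; apply: leq_trans (max_card _); apply: leq_trans les.
rewrite leq_mul2l /=; apply: subset_leq_card; apply/fintype.subsetP => t.
rewrite inE => /andP[Ct /eqP gt]; apply/setIP; split; first by rewrite inE.
by apply/afix1P; rewrite /= apermE; apply: val_inj; rewrite /= sg gt.
Qed.

End Subgroup.
End Tree.

Section Measure.
Import Order.TTheory GRing.Theory Num.Theory.
Local Open Scope classical_set_scope.
Local Open Scope ring_scope.
Local Open Scope ereal_scope.

(** * Cylinders and level sets *)

Section Boundary.
Variable A : pfinType.
Implicit Types (x y : boundary A) (v w : seq A) (C : pred (seq A)).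

Lemma take_vertex x m n : (m <= n)%N -> take m (vertex x n) = vertex x m.
Proof. by move=> mn; rewrite -map_take take_iota (minn_idPl mn). Qed.

Lemma size_vertex x n : size (vertex x n) = n.
Proof. exact: size_mkseq. Qed.

Lemma vertex_eq_letter x y n i : (i < n)%N -> vertex x n = vertex y n -> x i = y i.
Proof.
move=> ltin /(congr1 (fun s => nth (x i) s i)).
by rewrite !nth_mkseq.
Qed.

(** Otherwise [x] would be the limit of points outside [U], since convergence in
    the product of discrete spaces is eventual equality of each letter. *)
Lemma open_sub_cylinder (U : set (boundary A)) x :
  open U -> U x -> exists n, cylinder (vertex x n) `<=` U.
Proof.
move=> oU Ux; apply: contrapT => none.
have /choice[y yP] (n : nat) : exists y, vertex y n = vertex x n /\ ~ U y.
  apply: contrapT => no; apply: none; exists n => y.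
  rewrite /cylinder /= size_vertex => xy; apply: contrapT => nUy.
  by apply: no; exists y.
suff yx : y @ \oo --> x.
  have [N _ /(_ N (leqnn N))] : \forall n \near \oo, U (y n).
    by apply: yx; exact: open_nbhs_nbhs.
  by have [] := yP N.
apply/cvg_sup => i; move=> B /=; case=> _ [[W _ <-] /= Ox WB].
exists i.+1 => // n /= ltin; apply: WB => /=.
by rewrite (vertex_eq_letter ltin (yP n).1).
Qed.

Lemma measurable_cylinder v : measurable (cylinder v).
Proof.
(* For [i >= size v], the default value of [nth] makes the condition void. *)
have -> : cylinder v = \bigcap_i
    (@proj nat (fun=> discrete_topology A) i @^-1` [set a | nth a v i = a]).
  apply/seteqP; split=> x xv.
    move=> i _ /=; have [iv|vi] := ltnP i (size v); last by rewrite nth_default.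
    by rewrite -[in LHS]xv nth_mkseq.
  rewrite /cylinder /=; apply: (@eq_from_nth _ (x 0%N)); rewrite ?size_vertex // => i iv.
  by rewrite nth_mkseq // -[LHS](xv i I); exact: set_nth_default.
apply: bigcapT_measurable => i; apply: sub_sigma_algebra.
apply: open_comp => [x _|]; first exact: proj_continuous.
exact: discrete_open.
Qed.

(** These are exactly the clopen subsets of the boundary. *)
Definition level_set C n : set (boundary A) := [set x | C (vertex x n)].

Lemma level_setE C n : level_set C n =
  \big[setU/set0]_(t : n.-tuple A | C t) cylinder t.
Proof.
rewrite -bigcup_seq_cond; apply/seteqP; split=> x.
  move=> Cx; exists [tuple of vertex x n]; last by rewrite /cylinder /= size_vertex.
  by rewrite /= mem_index_enum.
by move=> [t /= /andP[_ Ct]]; rewrite /cylinder /= size_tuple /level_set /= => ->.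
Qed.

Lemma measurable_level_set C n : measurable (level_set C n).
Proof.
by rewrite level_setE; apply: bigsetU_measurable => t _; exact: measurable_cylinder.
Qed.

Lemma level_set_raise C m n : (m <= n)%N ->
  level_set C m = level_set (C \o take m) n.
Proof. by move=> mn; apply/seteqP; split=> x; rewrite /level_set /= take_vertex. Qed.

Lemma level_set0 n : level_set pred0 n = set0.
Proof. by apply/seteqP; split. Qed.

Lemma level_setC C n : ~` level_set C n = level_set (predC C) n.
Proof. by apply/seteqP; split=> x /negP. Qed.

Lemma level_setU C C' n : level_set C n `|` level_set C' n = level_set (predU C C') n.
Proof. by apply/seteqP; split=> x /orP. Qed.

Lemma cylinder_level_set v : cylinder v = level_set (pred1 v) (size v).
Proof. by apply/seteqP; split=> x /eqP. Qed.

End Boundary.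

(** * Approximation in measure *)

Section SymDiff.
Context (T : Type) (R : realType) (m : {outer_measure set T -> \bar R}%R).

Lemma outer_measure_setU_lt (X Y Z : set T) (a b : R) :
  X `<=` Y `|` Z -> m Y < a%:E -> m Z < b%:E -> m X < (a + b)%:E.
Proof.
move=> /(le_outer_measure m) XYZ ma mb; rewrite EFinD.
apply: le_lt_trans XYZ _; apply: le_lt_trans (outer_measureU2 m Y Z) _.
exact: lteD.
Qed.

Lemma setY_trans (X Y Z : set T) : X `+` Z `<=` (X `+` Y) `|` (Y `+` Z).
Proof.
move=> t /=; have [Yt|nYt] := pselect (Y t) => -[] [? ?].
- by right; left.
- by left; right.
- by left; left.
- by right; right.
Qed.

End SymDiff.

Section LevelApproximation.
Context (A : pfinType) (R : realType) (mu : probability (boundary A) R).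
Local Notation "mu^*" := (mu_ext mu).
Implicit Types (B D : set (boundary A)) (C : pred (seq A)).

Lemma level_set_le C n : uniform_bernoulli mu ->
  mu^* (level_set C n) <=
  ((#|[pred t : n.-tuple A | C t]|%:R / #|A|%:R ^+ n)%R : R)%:E.
Proof.
move=> bern; rewrite level_setE.
apply: (@le_trans _ _ (\sum_(t : n.-tuple A | C t) mu (cylinder t))).
  elim/big_ind2: _ => [|B r B' r' le le'|t _].
  - by rewrite outer_measure0.
  - exact: le_trans (outer_measureU2 _ _ _) (leeD le le').
  - by rewrite measurable_mu_extE //; exact: measurable_cylinder.
under eq_bigr do rewrite bern size_tuple.
by rewrite sumEFin big_const iter_addr_0 mulr_natl.
Qed.

(** Measurability is kept in the definition so that continuity of the measure
    can be used for countable unions. *)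
Definition level_approx B := measurable B /\
  forall e : R, (0 < e)%R -> exists C n, mu^* (B `+` level_set C n) < e%:E.

Lemma level_approx_level_set C n : level_approx (level_set C n).
Proof.
split; first exact: measurable_level_set.
by move=> e e0; exists C, n; rewrite setYK outer_measure0 lte_fin.
Qed.

Lemma level_approx0 : level_approx set0.
Proof. by rewrite -(level_set0 A 0); exact: level_approx_level_set. Qed.

Lemma level_approxC B : level_approx B -> level_approx (~` B).
Proof.
move=> [mB apx]; split; first exact: measurableC.
move=> e /apx[C [n lte]]; exists (predC C), n.
by rewrite -level_setC /setY !setDE !setCK setUC ![~` _ `&` _]setIC.
Qed.

Lemma level_approxU B D : level_approx B -> level_approx D ->
  level_approx (B `|` D).
Proof.
move=> [mB apxB] [mD apxD]; split; first exact: measurableU.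
move=> e e0; have e2 : (0 < e / 2)%R by rewrite divr_gt0.
have [C [m leC]] := apxB _ e2; have [C' [n leC']] := apxD _ e2.
exists (predU (C \o take m) (C' \o take n)), (maxn m n).
rewrite -level_setU -!level_set_raise ?leq_maxl ?leq_maxr // (splitr e).
apply: outer_measure_setU_lt leC leC' => x.
case=> -[[Bx|Dx] /not_orP[? ?]].
- by left; left.
- by right; left.
- by left; right.
- by right; right.
Qed.

(** A finite partial union already covers the countable union up to a small
    measure. *)
Lemma level_approx_bigcup (F : nat -> set (boundary A)) :
  (forall i, level_approx (F i)) -> level_approx (\bigcup_i F i).
Proof.
move=> apxF; have mF : measurable (\bigcup_i F i).
  by apply: bigcupT_measurable => i; exact: (apxF i).1.
split=> // e e0; have e2 : (0 < e / 2)%R by rewrite divr_gt0.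
pose U n := \big[setU/set0]_(i < n) F i.
have apxU n : level_approx (U n).
  apply: big_ind => [||i _]; [|exact: level_approxU|exact: apxF].
  exact: level_approx0.
have mD n : measurable (\bigcup_i F i `\` U n).
  by apply: measurableD => //; exact: (apxU n).1.
have D0 : \bigcap_n (\bigcup_i F i `\` U n) = set0.
  apply/seteqP; split=> // x xD; have [[i _ Fx] _] := xD 0%N I.
  have [_] := xD i.+1 I; apply; rewrite /U -bigcup_mkord; exists i => //=.
have cvD : mu (\bigcup_i F i `\` U n) @[n --> \oo] --> 0.
  rewrite -(measure0 mu) -D0; apply: nonincreasing_cvg_mu => //.
  - exact: le_lt_trans (probability_le1 _ _) (ltry _).
  - by rewrite D0.
  - by move=> m n mn; apply/subsetPset; apply: setDS; exact: subset_bigsetU mn.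
have e2E : 0 < (e / 2)%:E by rewrite lte_fin.
have [N _ /(_ N (leqnn N)) /= ltN] := cvD _ (open_ereal_lt' e2E).
have [C [n leC]] := (apxU N).2 _ e2.
exists C, n; rewrite (splitr e).
apply: outer_measure_setU_lt (@setY_trans _ _ (U N) _) _ leC.
have UF : U N `\` \bigcup_i F i = set0.
  by rewrite setD_eq0; exact: bigsetU_bigcup.
by rewrite setY_def UF setU0 /= measurable_mu_extE.
Qed.

(** The approximable sets form a sigma-algebra, and they include the open sets,
    which are countable unions of cylinders. *)
Lemma measurable_level_approx B : measurable B -> level_approx B.
Proof.
apply: smallest_sub; first split.
- exact: level_approx0.
- by move=> B' apx; rewrite setTD; exact: level_approxC.
- exact: level_approx_bigcup.
move=> U oU.
(* The words are countable: [F] enumerates the cylinders contained in [U]. *)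
pose F i := if unpickle i is Some v then
  if `[< cylinder v `<=` U >] then cylinder v else set0 else set0.
have -> : U = \bigcup_i F i.
  apply/seteqP; split=> [x Ux|x [i _]].
    have [n nU] := open_sub_cylinder oU Ux.
    exists (pickle (vertex x n)) => //; rewrite /F pickleK asboolT //.
    by rewrite /cylinder /= size_vertex.
  by rewrite /F; case: unpickle => // v; case: asboolP => // + vx; apply.
apply: level_approx_bigcup => i; rewrite /F.
case: unpickle => [v|]; last exact: level_approx0.
case: asboolP => _; last exact: level_approx0.
by rewrite cylinder_level_set; exact: level_approx_level_set.
Qed.

(** The union of a cover of [B] that nearly attains the infimum defining the outer
    measure exceeds [B] by a small set, because [B] splits additively the outer
    measure of this union. *)
Lemma caratheodory_borel_approx B (e : R) : (0 < e)%R ->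
  mu^*.-caratheodory B ->
  exists2 D : set (boundary A), measurable D & mu^* (B `+` D) < e%:E.
Proof.
move=> e0 cB.
have Bfin : mu^* B \is a fin_num.
  rewrite ge0_fin_numE ?outer_measure_ge0 //.
  apply: le_lt_trans (le_outer_measure _ _ _ (@subsetT _ B)) _.
  by rewrite /= measurable_mu_extE //= probability_setT ltry.
have [_ [F [mF BF] <-] ltF] := lb_ereal_inf_adherent e0 Bfin.
exists (\bigcup_i F i); first exact: bigcupT_measurable.
have lt : mu^* (\bigcup_i F i) < mu^* B + e%:E.
  apply: le_lt_trans ltF.
  apply: le_trans (outer_measure_sigma_subadditive _ _) _.
  by apply: lee_nneseries => // i _; rewrite /= measurable_mu_extE.
have -> : B `+` \bigcup_i F i = \bigcup_i F i `&` ~` B.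
  by rewrite setY_def -setDE (_ : B `\` _ = set0) ?set0U // setD_eq0.
move: lt; rewrite [X in X < _](cB (\bigcup_i F i)) (setIidr BF).
by rewrite lteD2lE.
Qed.

End LevelApproximation.

(** * Sets of fixed points *)

Section FixedPoints.
Context (A : pfinType) (R : realType) (mu : probability (boundary A) R).
Local Notation "mu^*" := (mu_ext mu).
Local Notation Fix := (fixed_points (@baction A)).

Lemma fixed_pointsE (g : tree_aut A) :
  Fix g = \bigcap_n level_set [pred w | g w == w] n.
Proof.
apply/seteqP; split=> x /= gx.
  by move=> n _; rewrite /level_set /= -vertex_baction gx.
apply: vertex_inj => n; rewrite vertex_baction; apply/eqP; exact: (gx n).
Qed.

Lemma measurable_fixed_points (g : tree_aut A) : measurable (Fix g).
Proof.
rewrite fixed_pointsE; apply: bigcapT_measurable => n.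
exact: measurable_level_set.
Qed.

Variable G : set (tree_aut A).
Hypotheses (bern : uniform_bernoulli mu) (subG : is_subgroup G)
  (wbG : weakly_branch G).

(** The fixed points contain the level set, and [few_fixed_words] bounds the
    excess. *)
Lemma level_set_fixed_points (C : pred (seq A)) n (e : R) : (0 < e)%R ->
  exists2 g, G g & mu^* (Fix g `+` level_set C n) < e%:E.
Proof.
move=> e0; pose k := Num.truncn e^-1.
have [m [g [nm Gg gfix few]]] := few_fixed_words subG wbG C n k.
exists g => //.
(* [F] holds at the level-[m] vertices of the fixed paths lying outside the level set. *)
pose F w := ~~ C (take n w) && (g w == w).
have sub : Fix g `+` level_set C n `<=` level_set F m.
  rewrite fixed_pointsE => x [[gx nCx]|[Cx ngx]].
    rewrite /level_set /F /= take_vertex //; apply/andP; split; last exact: (gx m).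
    exact/negP.
  (* [g] fixes long vertices of [x], hence all of them. *)
  exfalso; apply: ngx => i _; rewrite /level_set /=.
  have := gfix (vertex x (maxn n i)).
  rewrite size_vertex leq_maxl take_vertex ?leq_maxl // => /(_ isT Cx) gv.
  by rewrite -(take_vertex x (leq_maxr n i)) tree_aut_take gv.
apply: le_lt_trans (le_outer_measure mu^* _ _ sub) _.
apply: le_lt_trans (level_set_le F m bern) _; rewrite lte_fin.
have A0 : (0 < #|A|%:R ^+ m :> R)%R.
  by rewrite exprn_gt0 // ltr0n; apply/card_gt0P; exists point.
rewrite ltr_pdivrMr //; apply: (@le_lt_trans _ _ (k.+1%:R^-1 * #|A|%:R ^+ m)%R).
  by rewrite ler_pdivlMl // -natrX -natrM ler_nat.
rewrite ltr_pM2r // invf_plt ?posrE //.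
exact: truncnS_gt.
Qed.

(** Stated for the outer measure, which extends both [mu] and its completion. *)
Lemma outer_absolutely_nonfree (B : set (boundary A)) (e : R) : (0 < e)%R ->
  mu^*.-caratheodory B -> exists2 g, G g & mu^* (Fix g `+` B) < e%:E.
Proof.
move=> e0 cB; have e2 : (0 < e / 2)%R by rewrite divr_gt0.
have e4 : (0 < e / 2 / 2)%R by rewrite divr_gt0.
have [D mD] := caratheodory_borel_approx e2 cB; rewrite setYC => BD.
have [_ /(_ _ e4)[C [n]]] := measurable_level_approx mu mD; rewrite setYC => DC.
have [g Gg gC] := level_set_fixed_points C n e4.
exists g => //; rewrite (splitr e).
apply: outer_measure_setU_lt (@setY_trans _ _ D _) _ BD.
rewrite (splitr (e / 2)).
exact: outer_measure_setU_lt (@setY_trans _ _ (level_set C n) _) gC DC.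
Qed.

End FixedPoints.

End Measure.

Theorem theorem15 (R : realType) (d : nat) (d_ge2 : (2 <= d)%N)
    (A : pfinType) (cardA : #|A| = d)
    (mu : probability (boundary A) R) (mu_bernoulli : uniform_bernoulli mu)
    (G : set (tree_aut A)) (subG : is_subgroup G) (wbG : weakly_branch G) :
  absolutely_nonfree mu G (@baction A) /\
  absolutely_nonfree (@completed_measure_extension _ _ _ mu) G (@baction A).
Proof.
split=> B mB e e0; last exact: outer_absolutely_nonfree.
have cB := @caratheodory_measurable_mu_ext _ _ _ mu _ mB.
have [g Gg] := outer_absolutely_nonfree mu_bernoulli subG wbG e0 cB.
exists g => //; rewrite -measurable_mu_extE //.
by apply: measurableU; apply: measurableD => //; exact: measurable_fixed_points.
Qed.
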